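(* The robust predecessor operator $\mathcal F^{-1}:2^{\mathcal X}\to 2^{\mathcal X}$ admits a greatest fixed point $\mathcal M$ with respect to set inclusion. In particular, $\mathcal M=\mathcal F^{-1}(\mathcal M)$ and $$\mathcal M=\bigcup\{\mathcal S\subseteq\mathcal X:\ \mathcal S\subseteq\mathcal F^{-1}(\mathcal S)\}.$$ Furthermore, $\mathcal M$ coincides with the maximal robust positively invariant set.
   Context: Let $\mathscr A\subseteq\mathbb R^{n\times n}$ be a nonempty family of matrices, $\mathcal W\subseteq\mathbb R^n$ a nonempty set (disturbances), and $\mathcal X\subseteq\mathbb R^n$ a set (state constraint). The linear difference inclusion is $x^+\in\mathcal F(x):=\{Ax+w: A\in\mathscr A,\ w\in\mathcal W\}$. A set $\mathcal S\subseteq\mathbb R^n$ is robust positively invariant if and only if for all $x\in\mathcal S$ one has $\mathcal F(x)\subseteq\mathcal S$ and $x\in\mathcal X$. The maximal robust positively invariant set is a robust positively invariant set that contains every other robust positively invariant set. For $\mathcal S\subseteq\mathbb R^n$ the robust predecessor set is $\mathcal F^{-1}(\mathcal S):=\{x\in\mathbb R^n:\mathcal F(x)\subseteq\mathcal S\}\cap\mathcal X$; the robust predecessor operator is its restriction to a self-map of the power set $2^{\mathcal X}$ of $\mathcal X$. A fixed point is a set $\mathcal S\in 2^{\mathcal X}$ with $\mathcal F^{-1}(\mathcal S)=\mathcal S$. *)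

(* Defs.v *)
From mathcomp Require Import all_boot all_order all_algebra.
From mathcomp Require Import boolp classical_sets functions reals.

Set Implicit Arguments.
Unset Strict Implicit.
Unset Printing Implicit Defensive.

Import GRing.Theory.
Local Open Scope classical_set_scope.
Local Open Scope ring_scope.

Definition power_set (T : Type) (X : set T) : set (set T) :=
  [set S | S `<=` X].

(* For f mapping the family D of sets to itself; fixed points outside D do not
   count. *)
Definition fixed_point (T : Type) (D : set (set T)) (f : set T -> set T)
    (S : set T) : Prop :=
  D S /\ f S = S.

Definition greatest_fixed_point (T : Type) (D : set (set T))
    (f : set T -> set T) (M : set T) : Prop :=
  fixed_point D f M /\ forall S, fixed_point D f S -> S `<=` M.

Section LinearDifferenceInclusion.
Variables (R : realType) (n : nat).
Variables (AA : set 'M[R]_n) (W X : set 'cV[R]_n).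
Implicit Types (x : 'cV[R]_n) (S : set 'cV[R]_n).

Definition inclusion_map x : set 'cV[R]_n :=
  [set A *m x + w | A in AA & w in W].

Definition robust_positively_invariant S : Prop :=
  forall x, S x -> inclusion_map x `<=` S /\ X x.

Definition maximal_robust_positively_invariant S : Prop :=
  robust_positively_invariant S /\
  forall S', robust_positively_invariant S' -> S' `<=` S.

Definition robust_predecessor S : set 'cV[R]_n :=
  [set x | inclusion_map x `<=` S] `&` X.

End LinearDifferenceInclusion.

(* Main.v *)
Require Import Defs.
From mathcomp Require Import all_boot all_order all_algebra.
From mathcomp Require Import boolp classical_sets functions reals.

Local Open Scope classical_set_scope.
Local Open Scope ring_scope.

(** The subsets of [X] form a complete lattice, and the robust predecessor
    operator is monotone: the constraint that every successor of [x] lies in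
    [S] only becomes weaker as [S] grows.  The Knaster-Tarski theorem
    ([union_post_fixed_points_greatest]) therefore makes the union of all
    post-fixed points, the sets with [S `<=` f S], the greatest fixed point.

    The link with invariance is that the post-fixed points of the robust
    predecessor operator are precisely the robust positively invariant sets
    ([robust_positively_invariantP]), so their union is at once the greatest
    fixed point and the maximal robust positively invariant set. *)

Section KnasterTarski.
Variables (T : Type) (X : set T) (f : set T -> set T).
Hypothesis f_power_set : set_fun (power_set X) (power_set X) f.
Hypothesis f_monotone : {homo f : S S' / S `<=` S'}.

Let M := \bigcup_(S in [set S | S `<=` X /\ S `<=` f S]) S.

Lemma union_post_fixed_points_post_fixed : M `<=` f M.
Proof.
move=> x [S [SX SfS] Sx].
by apply: (f_monotone S M) (SfS _ Sx); apply: bigcup_sup.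
Qed.

(** Applying the monotone [f] to [M `<=` f M] shows that [f M] is itself a
    post-fixed point, hence one of the sets whose union is [M]; this is the
    inclusion [f M `<=` M]. *)
Lemma union_post_fixed_points_greatest :
  greatest_fixed_point (power_set X) f M.
Proof.
have MX : M `<=` X by move=> x [S [SX _] /SX].
have MfM := union_post_fixed_points_post_fixed.
split; last by move=> S [SX fS]; apply: bigcup_sup; split; rewrite ?fS.
split=> //; apply/seteqP; split=> //.
by apply: bigcup_sup; split; [exact: f_power_set | exact: f_monotone].
Qed.

End KnasterTarski.

Lemma robust_predecessor_power_set (R : realType) (n : nat)
    (AA : set 'M[R]_n) (W X : set 'cV[R]_n) :
  set_fun (power_set X) (power_set X) (robust_predecessor AA W X).
Proof. by move=> S _ x []. Qed.

Lemma robust_predecessor_monotone (R : realType) (n : nat)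
    (AA : set 'M[R]_n) (W X : set 'cV[R]_n) :
  {homo robust_predecessor AA W X : S S' / S `<=` S'}.
Proof. by move=> S S' SS' x [FxS Xx]; split=> // y /FxS /SS'. Qed.

(** Membership in the robust predecessor set combines the successor condition
    with the state constraint, which are the two clauses of invariance.  The
    right-hand side is the membership condition of the index set of the
    Knaster-Tarski union. *)
Lemma robust_positively_invariantP (R : realType) (n : nat)
    (AA : set 'M[R]_n) (W X S : set 'cV[R]_n) :
  robust_positively_invariant AA W X S <->
  S `<=` X /\ S `<=` robust_predecessor AA W X S.
Proof. by split=> [invS | [_ SpS] x /SpS //]; split=> x /invS []. Qed.

Theorem theorem1 (R : realType) (n : nat)
    (AA : set 'M[R]_n) (W X : set 'cV[R]_n)
    (AA_nonempty : AA !=set0) (W_nonempty : W !=set0) :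
  set_fun (power_set X) (power_set X) (robust_predecessor AA W X) /\
  exists M : set 'cV[R]_n,
    [/\ greatest_fixed_point (power_set X) (robust_predecessor AA W X) M,
        M = robust_predecessor AA W X M,
        M = \bigcup_(S in [set S : set 'cV[R]_n |
               S `<=` X /\ S `<=` robust_predecessor AA W X S]) S
      & maximal_robust_positively_invariant AA W X M].
Proof.
have pX := @robust_predecessor_power_set R n AA W X.
have pmono := @robust_predecessor_monotone R n AA W X.
have gfpM := @union_post_fixed_points_greatest _ X _ pX pmono.
split=> //; eexists; split; [exact: gfpM | by case: gfpM => -[] | by [] |].
case: gfpM => -[MX fixM] _; split.
  by apply/robust_positively_invariantP; split; rewrite ?fixM.
by move=> S /robust_positively_invariantP postS; apply: bigcup_sup.
Qed.
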